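(* Let $\ell\ge2$, $r\ge2$, $m\in\mathbb{Z}_{>0}$, $k\in\mathbb{Z}$ with $k\geq -m-1$, and integers $\overline{m}_1,\dots,\overline{m}_\ell$ with $0\le\overline{m}_i\le r-1$ such that $m_i:=r(m+k)+1+\overline{m}_i\ge0$ for all $i$. Let $(\mathcal{A},\mu')$ be the multiarrangement in $\mathbb{C}^\ell$ with defining polynomial \[ Q(\mathcal{A},\mu')=\prod_{i=1}^\ell x_i^{m_i}\cdot\prod_{1\le i<j\le\ell}(x_i^r-x_j^r)^{2m}, \] i.e. the hyperplane $x_i=0$ has multiplicity $m_i$ and each hyperplane $x_i-\zeta x_j=0$ ($i<j$, $\zeta^r=1$) has multiplicity $2m$. Let $\lambda(t)=\prod_{i=1}^\ell(t^r-x_i^r)$, $\lambda_i(t)=\lambda(t)/(t^r-x_i^r)$, and for $1\le i\le\ell$ \[ \sigma_i^m=\sum_{j=1}^\ell\left(\int^{x_j}t^{r(k+1)}\lambda(t)^{m-1}\lambda_i(t)\,dt\right)\partial_j . \] Then the vector fields $x_1^{\overline{m}_1}\sigma_1^m,\ x_2^{\overline{m}_2}\sigma_2^m,\ \dots,\ x_\ell^{\overline{m}_\ell}\sigma_\ell^m$ form a basis of the $S$-module $D(\mathcal{A},\mu')$.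
   Context: $S=\mathbb{C}[x_1,\dots,x_\ell]$, $\partial_i=\partial/\partial x_i$, $\operatorname{Der}_S=\bigoplus_iS\partial_i$. For a multiarrangement $(\mathcal{A},\mu)$ (linear hyperplanes $H=\ker\alpha_H$ with multiplicities $\mu(H)\in\mathbb{Z}_{\ge0}$), $D(\mathcal{A},\mu)=\{\delta\in\operatorname{Der}_S\mid\delta\alpha_H\in(\alpha_H^{\mu(H)})\ \forall H\}$. The operator $\int^{x_j}\,dt$ is the linear operator on Laurent polynomials in $t$ with coefficients in $\mathbb{C}[x_1,\dots,x_\ell]$ given by $\int^{x_j}t^n\,dt=\frac{x_j^{n+1}}{n+1}$ for $n\neq-1$ (all exponents of $t$ occurring are multiples of $r$, so $n=-1$ never occurs); for $n\ge0$ it equals $\int_0^{x_j}$. *)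

(* Defs.v *)
From HB Require Import structures.
From mathcomp Require Import all_boot all_order all_algebra.
From mathcomp Require Import cyclotomic separable.
From mathcomp Require Import complex reals mpoly.

Set Implicit Arguments.
Unset Strict Implicit.
Unset Printing Implicit Defensive.

Import Order.TTheory GRing.Theory Num.Theory.
Local Open Scope ring_scope.

Definition is_basis (S : pzRingType) (M : lmodType S) (D : M -> Prop)
    (n : nat) (b : 'I_n -> M) : Prop :=
  [/\ forall i, D (b i),
      forall c : 'I_n -> S, \sum_(i < n) c i *: b i = 0 -> forall i, c i = 0
    & forall v, D v -> exists c : 'I_n -> S, v = \sum_(i < n) c i *: b i].

Local Notation "x %:F" := (tofrac x).

Section MultiArrangement.
Variables (F : fieldType) (l : nat).
Local Notation S := {mpoly F[l]}.

(* The row d stands for \sum_i (d 0 i) \partial_i in Der_S = \bigoplus_i S \partial_i. *)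
Definition vfield := 'rV[S]_l.

Definition vf_apply (d : vfield) (f : S) : S :=
  \sum_(i < l) d 0 i * mderiv i f.

(* A multiarrangement is listed as pairs (alpha_H, mu(H)); multiplicity 0 is
   allowed. *)
Definition multiarr := seq (S * nat).

(* The alpha_H are nonzero linear forms defining distinct hyperplanes. *)
Definition multiarr_wf (A : multiarr) : Prop :=
  [/\ uniq (unzip1 A),
      {in unzip1 A, forall a, a != 0 /\ a \is 1.-homog}
    & {in unzip1 A &, forall a b (c : F), a = c *: b -> a = b}].

Definition defpoly (A : multiarr) : S := \prod_(H <- A) H.1 ^+ H.2.

Definition logder (A : multiarr) (d : vfield) : Prop :=
  forall H, H \in A -> exists g : S, vf_apply d H.1 = g * H.1 ^+ H.2.

Lemma logder0 A : logder A 0.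
Proof.
move=> H _; exists 0; rewrite mul0r /vf_apply big1 // => i _.
by rewrite mxE mul0r.
Qed.

Lemma logder_lin A (a : S) d1 d2 :
  logder A d1 -> logder A d2 -> logder A (a *: d1 + d2).
Proof.
move=> h1 h2 H HA; have [g1 e1] := h1 H HA; have [g2 e2] := h2 H HA.
exists (a * g1 + g2); rewrite mulrDl -mulrA -e1 -e2 /vf_apply mulr_sumr.
by rewrite -big_split /=; apply: eq_bigr => i _; rewrite !mxE mulrDl mulrA.
Qed.

End MultiArrangement.

Section UnityRoots.
Variable F : closedFieldType.

Definition unity_roots (r : nat) : seq F :=
  sval (closed_field_poly_normal ('X^r - 1 : {poly F})).

Lemma unity_rootsE r : (0 < r)%N ->
  'X^r - 1 = \prod_(z <- unity_roots r) ('X - z%:P).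
Proof.
move=> r_gt0; rewrite /unity_roots; case: closed_field_poly_normal => s /= ->.
have /monicP -> : ('X^r - 1 : {poly F}) \is monic by apply: monicXnsubC.
by rewrite scale1r.
Qed.

Lemma mem_unity_roots r z : (0 < r)%N -> (z \in unity_roots r) = (z ^+ r == 1).
Proof.
move=> r_gt0; rewrite -root_prod_XsubC -unity_rootsE // rootE !hornerE.
by rewrite subr_eq0.
Qed.

Lemma uniq_unity_roots r : r%:R != 0 :> F -> uniq (unity_roots r).
Proof.
move=> r_neq0; rewrite -separable_prod_XsubC -unity_rootsE.
  exact: separable_Xn_sub_1.
by case: r r_neq0 => //; rewrite eqxx.
Qed.

End UnityRoots.

Section MonomialMultiArrangement.
Variables (F : closedFieldType) (l : nat).
Local Notation S := {mpoly F[l]}.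

Definition mon_multiarr (r m : nat) (mu : 'I_l -> nat) : multiarr F l :=
  [seq ('X_i, mu i) | i <- enum 'I_l] ++
  [seq ('X_ij.1 - z *: 'X_ij.2, (2 * m)%N)
     | ij <- enum [pred ij : 'I_l * 'I_l | (ij.1 < ij.2)%N],
       z <- unity_roots F r].

Lemma prod_unity_forms r (x y : S) : (0 < r)%N ->
  \prod_(z <- unity_roots F r) (x - z *: y) = x ^+ r - y ^+ r.
Proof.
move=> r_gt0; have sz : size (unity_roots F r) = r.
  apply/eqP; rewrite -eqSS -(size_prod_XsubC _ id) -unity_rootsE //.
  by rewrite -[1]/(1%:P) size_XnsubC.
have [->|y0] := eqVneq y 0.
  under eq_bigr do rewrite scaler0 subr0.
  by rewrite big_const_seq count_predT sz iter_mulr_1 expr0n gtn_eqF // subr0.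
apply/eqP; rewrite -tofrac_eq; apply/eqP; rewrite rmorphB !rmorphXn rmorph_prod /=.
have yF0 : y%:F != 0 by rewrite tofrac_eq0.
pose f : {rmorphism F -> {fraction S}} := (@tofrac S) \o (@mpolyC l F).
have := congr1 (fun p => (map_poly f p).[x%:F / y%:F]) (unity_rootsE F r_gt0).
rewrite /= rmorphB /= map_polyXn rmorph1 !hornerE rmorph_prod horner_prod /=.
move=> /(congr1 ( *%R (y%:F ^+ r))).
rewrite mulrBr mulr1 -exprMn mulrCA divff // mulr1 => ->.
rewrite -{2}sz -[size _](count_predT) -iter_mulr_1 -big_const_seq -big_split /=.
apply: eq_bigr => z _; rewrite map_polyXsubC hornerXsubC mulrBr mulrCA divff //.
by rewrite mulr1 rmorphB /= -mul_mpolyC rmorphM /= mulrC [X in _ - X]mulrC.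
Qed.

Lemma defpoly_mon_multiarr r m mu : (0 < r)%N ->
  defpoly (mon_multiarr r m mu) =
  (\prod_(i < l) 'X_i ^+ mu i) *
  \prod_(i < l) \prod_(j < l | (i < j)%N) ('X_i ^+ r - 'X_j ^+ r) ^+ (2 * m).
Proof.
move=> r_gt0; rewrite /defpoly big_cat /= big_map big_enum /=; congr (_ * _).
rewrite big_allpairs_dep /= big_enum_cond /=.
rewrite pair_big_dep /=; apply: eq_big => [[i j]|[i j] _] /=.
  by rewrite andbT.
by rewrite prodrXl prod_unity_forms.
Qed.

Lemma coord_form_coef (i j : 'I_l) : ('X_i : S)@_U_(j) = (i == j)%:R.
Proof. exact: mcoeffXU. Qed.

Lemma diff_form_coef (i j k : 'I_l) (z : F) :
  ('X_i - z *: 'X_j : S)@_U_(k) = (i == k)%:R - z * (j == k)%:R.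
Proof. by rewrite mcoeffB mcoeffZ !mcoeffXU. Qed.

Lemma coord_form_prop (i j : 'I_l) (c : F) :
  'X_i = c *: 'X_j :> S -> i = j.
Proof.
move=> /(congr1 (fun p => p@_U_(i))); rewrite mcoeffZ !mcoeffXU eqxx.
by case: eqVneq => // _ /eqP; rewrite mulr0 oner_eq0.
Qed.

Lemma coord_diff_form_prop (i j k : 'I_l) (z c : F) : (j < k)%N -> z != 0 ->
  'X_i <> c *: ('X_j - z *: 'X_k) :> S.
Proof.
move=> ltjk z0 e; have njk : j != k by rewrite neq_ltn ltjk.
have E n := congr1 (fun p => p@_U_(n)) e.
have := E j; have := E k; have := E i.
rewrite !mcoeffZ !diff_form_coef !mcoeffXU !eqxx.
rewrite (negbTE njk) (eq_sym k j) (negbTE njk) mulr0 mulr1 subr0 sub0r mulr1.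
move=> Ei Ek Ej; have c0 : c != 0.
  by apply/eqP => c0; move/eqP: Ei; rewrite c0 mul0r oner_eq0.
have ij : i == j by case: eqP Ej => // _ /esym/eqP; rewrite (negbTE c0).
have ik : i == k.
  case: eqP Ek => // _ /esym/eqP; rewrite mulrN oppr_eq0 mulf_eq0.
  by rewrite (negbTE c0) (negbTE z0).
by move: njk; rewrite -(eqP ij) -(eqP ik) eqxx.
Qed.

Lemma diff_coord_form_prop (i j k : 'I_l) (z c : F) : (j < k)%N -> z != 0 ->
  'X_j - z *: 'X_k <> c *: 'X_i :> S.
Proof.
move=> ltjk z0 e; have [c0|c0] := eqVneq c 0.
  have /(congr1 (fun p => p@_U_(j))) := e; rewrite c0 scale0r mcoeff0.
  rewrite diff_form_coef eqxx [k == j]gtn_eqF // mulr0 subr0.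
  by move/eqP; rewrite oner_eq0.
apply: (@coord_diff_form_prop i j k z c^-1 ltjk z0).
by rewrite e scalerA mulVf // scale1r.
Qed.

Lemma diff_form_prop (i j i' j' : 'I_l) (z z' c : F) :
  (i < j)%N -> (i' < j')%N -> z != 0 -> z' != 0 ->
  'X_i - z *: 'X_j = c *: ('X_i' - z' *: 'X_j') :> S ->
  [/\ i = i', j = j' & z = z'].
Proof.
move=> lt lt' z0 z0' e; have E n := congr1 (fun p => p@_U_(n)) e.
have := E i; have := E j; rewrite !mcoeffZ !diff_form_coef !eqxx.
rewrite [i == j]ltn_eqF // [j == i]gtn_eqF // mulr0 subr0 sub0r mulr1.
have [eii'|nii'] := eqVneq i' i; have [eji'|nji'] := eqVneq j' i;
have [eij'|nij'] := eqVneq i' j; have [ejj'|njj'] := eqVneq j' j; subst;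
  rewrite ?ltnn /= ?mulr0n ?mulr1n ?(oppr0, mulr0, mulr1, subr0, sub0r) //;
  try by [move: lt lt'; rewrite ?ltnn];
  try by [move=> /eqP; rewrite oppr_eq0 (negbTE z0)];
  try by [move=> _ /eqP; rewrite oner_eq0].
- by move=> + c1; rewrite -c1 mul1r => /oppr_inj.
- by have := ltn_trans lt lt'; rewrite ltnn.
Qed.

Lemma mon_multiarrP r m mu a : (0 < r)%N ->
  a \in unzip1 (mon_multiarr r m mu) ->
  (exists i, a = 'X_i) \/
  (exists (i j : 'I_l) (z : F), [/\ (i < j)%N, z != 0 & a = 'X_i - z *: 'X_j]).
Proof.
move=> r_gt0; rewrite /mon_multiarr /unzip1 map_cat mem_cat => /orP[].
  by rewrite -map_comp => /mapP[i _ ->]; left; exists i.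
case/mapP => H /allpairsP[[[i j] z] /= [+ + ->]] ->.
rewrite mem_enum mem_unity_roots // => lt /eqP z1; right; exists i, j, z.
split=> //; apply/eqP => z0; move/eqP: z1.
by rewrite z0 expr0n gtn_eqF // eq_sym oner_eq0.
Qed.

Lemma mon_multiarr_wf r m mu : r%:R != 0 :> F ->
  multiarr_wf (mon_multiarr r m mu).
Proof.
move=> rF; have r_gt0 : (0 < r)%N by case: r rF => //; rewrite eqxx.
have nz z : z \in unity_roots F r -> z != 0.
  rewrite mem_unity_roots //; apply: contraL => /eqP ->.
  by rewrite expr0n gtn_eqF // eq_sym oner_eq0.
split.
- rewrite /mon_multiarr /unzip1 map_cat cat_uniq -map_comp; apply/and3P; split.
  + rewrite map_inj_uniq ?enum_uniq // => i j /= e.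
    by apply: (@coord_form_prop _ _ 1); rewrite scale1r.
  + apply/hasPn => a /mapP[H /allpairsP[[[i j] z] /= [+ /nz z0 ->]] ->] /=.
    rewrite mem_enum => /= lt; apply/mapP => -[i' _ /= e].
    by apply: (@diff_coord_form_prop i' i j z 1 lt z0); rewrite scale1r.
  + rewrite map_allpairs; apply: allpairs_uniq; rewrite ?enum_uniq //.
      exact: uniq_unity_roots.
    move=> u v /allpairsP[[[i j] z] /= [+ + ->]]; rewrite mem_enum => lt /nz z0.
    move=> /allpairsP[[[i' j'] z'] /= [+ + ->]]; rewrite mem_enum.
    move=> lt' /nz z0' /= e.
    have [|/= -> -> ->] // := @diff_form_prop i j i' j' z z' 1 lt lt' z0 z0'.
    by rewrite scale1r.
- move=> a /(mon_multiarrP r_gt0) [[i ->]|[i [j [z [lt z0 ->]]]]]; split.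
  + by apply/eqP => /(congr1 (fun p => p@_U_(i))) /eqP;
      rewrite mcoeffXU mcoeff0 eqxx oner_eq0.
  + by rewrite dhomogX; apply/eqP; exact: mdeg1.
  + apply/eqP => /(congr1 (fun p => p@_U_(i))) /eqP.
    by rewrite diff_form_coef mcoeff0 eqxx [j == i]gtn_eqF // mulr0 subr0 oner_eq0.
  + apply: rpredB; last apply: rpredZ;
      by rewrite dhomogX; apply/eqP; exact: mdeg1.
- move=> a b /(mon_multiarrP r_gt0) Ha /(mon_multiarrP r_gt0) Hb c.
  case: Ha => [[i ->]|[i [j [z [lt z0 ->]]]]];
  case: Hb => [[i' ->]|[i' [j' [z' [lt' z0' ->]]]]].
  + by move=> /coord_form_prop ->.
  + by move=> /coord_diff_form_prop -/(_ lt' z0').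
  + by move=> /diff_coord_form_prop -/(_ lt z0).
  + by move=> /(diff_form_prop lt lt' z0 z0') [-> -> ->].
Qed.

End MonomialMultiArrangement.

Section Integral.
Variables (F : fieldType) (l : nat).
Local Notation S := {mpoly F[l]}.

(* \int^{x_j} t^e p(t) dt for the Laurent polynomial t^e p(t), e : int and
   p : {poly S}; the value has negative powers of x_j in general, so it is
   taken in the fraction field of S. *)
Definition laurent_int (j : 'I_l) (e : int) (p : {poly S}) : {fraction S} :=
  \sum_(n < size p)
    (p`_n)%:F * ('X_j)%:F ^ (e + n%:Z + 1) / (e + n%:Z + 1)%:~R.

Lemma laurent_int_wide j e (p : {poly S}) N : (size p <= N)%N ->
  laurent_int j e p =
  \sum_(n < N) (p`_n)%:F * ('X_j)%:F ^ (e + n%:Z + 1) / (e + n%:Z + 1)%:~R.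
Proof.
move=> leN; rewrite /laurent_int.
rewrite (big_ord_widen N (fun n : nat => (p`_n)%:F * ('X_j)%:F ^ (e + n%:Z + 1)
  / (e + n%:Z + 1)%:~R)) // big_mkcond; apply: eq_bigr => n _.
by case: ltnP => // le_p; rewrite nth_default // rmorph0 !mul0r.
Qed.

(* The value does not depend on the writing t^e p(t) of the integrand. *)
Lemma laurent_int_shift j e (p : {poly S}) :
  laurent_int j e (p * 'X) = laurent_int j (e + 1) p.
Proof.
rewrite (@laurent_int_wide j e _ (size p).+1) /=; last first.
  by have [->|p0] := eqVneq p 0; [rewrite mul0r size_poly0 | rewrite size_mulX].
rewrite big_ord_recl coefMX eqxx rmorph0 !mul0r add0r; apply: eq_bigr => n _.
by rewrite coefMX /= -[bump 0 n]/(n.+1) intS !addrA.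
Qed.

Definition lambda (r : nat) : {poly S} :=
  \prod_(i < l) ('X^r - ('X_i ^+ r)%:P).

Definition lambda_i (r : nat) (i : 'I_l) : {poly S} :=
  \prod_(j < l | j != i) ('X^r - ('X_j ^+ r)%:P).

Lemma lambda_iE r i : lambda_i r i * ('X^r - ('X_i ^+ r)%:P) = lambda r.
Proof. by rewrite /lambda (bigD1 i) //= mulrC. Qed.

(* Coefficients of sigma_i^m on \partial_1, ..., \partial_l. *)
Definition sigma (r m : nat) (k : int) (i : 'I_l) : 'rV[{fraction S}]_l :=
  \row_j laurent_int j (r%:Z * (k + 1)) (lambda r ^+ (m - 1) * lambda_i r i).

End Integral.

(* m_i = r (m + k) + 1 + \overline{m}_i *)
Definition coord_mult (r m : nat) (k : int) (mb : nat) : int :=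
  r%:Z * (m%:Z + k) + 1 + mb%:Z.

(* Main.v *)
(* Put T = t^r and y_j = x_j^r; the integrand of sigma_i becomes a shifted
   polynomial in T whose termwise integral W_i satisfies a first order equation
   r T W' + e W = prod_j (T - y_j)^(m - [j = i]).

   Membership: applied to x_j - z x_k, sigma_i gives the integral from z x_k to
   x_j of a function having at least 2m - 1 zeros (with multiplicity) at these
   endpoints; reading the equation on Taylor coefficients at z x_k shows that
   (x_j - z x_k)^(2m) divides it.

   Independence: a relation between the sigma_i yields a combination h of the
   right-hand sides whose integral W vanishes at every y_j; since h vanishes
   there to order m - 1, W vanishes to order m, but deg W < l m, so W = 0.

   Basis: the determinant of the coefficient matrix is nonzero, is divisible by
   the defining polynomial Q and has degree at most deg Q, so it is a constant
   multiple of Q, and Cramer's rule concludes as in Saito's criterion. *)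

Require Import Defs.
From HB Require Import structures.
From mathcomp Require Import all_boot all_order all_algebra.
From mathcomp Require Import ring zify.
From mathcomp Require Import complex reals mpoly.

Set Implicit Arguments.
Unset Strict Implicit.
Unset Printing Implicit Defensive.

Import Order.TTheory GRing.Theory Num.Theory.
Local Open Scope ring_scope.
Local Open Scope complex_scope.

(** * Divisibility and prime elements *)

Definition rdvd (R : pzRingType) (a b : R) : Prop := exists g, b = g * a.

Section Divisibility.
Variable R : comNzRingType.
Implicit Types a b c d : R.

Lemma rdvd_refl a : rdvd a a.
Proof. by exists 1; rewrite mul1r. Qed.

Lemma rdvd1r a : rdvd 1 a.
Proof. by exists a; rewrite mulr1. Qed.

Lemma rdvd0 a : rdvd a 0.
Proof. by exists 0; rewrite mul0r. Qed.

Lemma rdvdD a b c : rdvd a b -> rdvd a c -> rdvd a (b + c).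
Proof. by move=> [g ->] [h ->]; exists (g + h); rewrite mulrDl. Qed.

Lemma rdvdMl a b c : rdvd a b -> rdvd a (c * b).
Proof. by move=> [g ->]; exists (c * g); rewrite mulrA. Qed.

Lemma rdvdMr a b c : rdvd a b -> rdvd a (b * c).
Proof. by rewrite mulrC; apply: rdvdMl. Qed.

Lemma rdvdN a b : rdvd a b -> rdvd a (- b).
Proof. by rewrite -mulN1r; apply: rdvdMl. Qed.

Lemma rdvdB a b c : rdvd a b -> rdvd a c -> rdvd a (b - c).
Proof. by move=> ? ?; apply/rdvdD/rdvdN. Qed.

Lemma rdvdM a b c d : rdvd a b -> rdvd c d -> rdvd (a * c) (b * d).
Proof. by move=> [g ->] [h ->]; exists (g * h); rewrite mulrACA. Qed.

Lemma rdvd_trans b a c : rdvd a b -> rdvd b c -> rdvd a c.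
Proof. by move=> [g ->] [h ->]; exists (h * g); rewrite mulrA. Qed.

Lemma rdvd_exp2l a m n : (m <= n)%N -> rdvd (a ^+ m) (a ^+ n).
Proof. by move=> /subnK <-; exists (a ^+ (n - m)); rewrite exprD. Qed.

Lemma rdvd_sum a I (s : seq I) (P : pred I) f :
  (forall i, P i -> rdvd a (f i)) -> rdvd a (\sum_(i <- s | P i) f i).
Proof.
by move=> h; apply: (big_ind (rdvd a)) => //; [apply: rdvd0|apply: rdvdD].
Qed.

End Divisibility.

Definition prime_elt (R : pzRingType) (p : R) : Prop :=
  p <> 0 /\ forall a b, rdvd p (a * b) -> rdvd p a \/ rdvd p b.

Section PrimeElements.
Variable R : idomainType.
Implicit Types p a b : R.

Lemma prime_expM_cancel p b n a : prime_elt p -> ~ rdvd p b ->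
  rdvd (p ^+ n) (b * a) -> rdvd (p ^+ n) a.
Proof.
move=> [/eqP p0 pP] pb; elim: n a => [|n IH] a; first by move=> _; apply: rdvd1r.
case=> g e; have [//|[h ea]] : rdvd p b \/ rdvd p a.
  by apply: pP; rewrite e exprSr mulrA; exists (g * p ^+ n).
rewrite ea exprSr; apply: rdvdM (rdvd_refl p); apply: IH.
by exists g; apply: (mulIf p0); rewrite -mulrA -ea e exprSr mulrA.
Qed.

Lemma prime_expX_cancel p b n k a : prime_elt p -> ~ rdvd p b ->
  rdvd (p ^+ n) (b ^+ k * a) -> rdvd (p ^+ n) a.
Proof.
move=> pP pb; elim: k => [|k IH]; first by rewrite mul1r.
by rewrite exprS -mulrA => /(prime_expM_cancel pP pb)/IH.
Qed.

Lemma prime_exp_prod_cancel p (s : seq (R * nat)) n a : prime_elt p ->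
  (forall H, H \in s -> ~ rdvd p H.1) ->
  rdvd (p ^+ n) (a * \prod_(H <- s) H.1 ^+ H.2) -> rdvd (p ^+ n) a.
Proof.
move=> pP; elim: s => [|H s IH] nd; first by rewrite big_nil mulr1.
have ndH : ~ rdvd p H.1 by apply: nd; rewrite inE eqxx.
rewrite big_cons mulrCA => /(prime_expX_cancel pP ndH); apply: IH => H' H's.
by apply: nd; rewrite inE H's orbT.
Qed.

(** Stands in for unique factorization: once [a] is a multiple [g] of the product over the tail, the
    tail primes, not divisible by [p], cancel one by one and [p ^+ n] must divide [g]. *)
Lemma rdvd_prod_prime_exp (s : seq (R * nat)) a : uniq (unzip1 s) ->
  {in unzip1 s, forall p, prime_elt p} ->
  {in unzip1 s &, forall p q, rdvd p q -> p = q} ->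
  (forall H, H \in s -> rdvd (H.1 ^+ H.2) a) ->
  rdvd (\prod_(H <- s) H.1 ^+ H.2) a.
Proof.
elim: s => [|[p n] s IH] /=; first by rewrite big_nil => *; apply: rdvd1r.
case/andP=> ps us prs ds ha; rewrite big_cons /=.
have [||H Hs|g ea] := IH us.
- by move=> q qs; apply: prs; rewrite inE qs orbT.
- by move=> q q' qs qs'; apply: ds; rewrite inE ?qs ?qs' orbT.
- by apply: ha; rewrite inE Hs orbT.
have pP : prime_elt p by apply: prs; rewrite inE eqxx.
have nd H : H \in s -> ~ rdvd p H.1.
  move=> Hs; have H1 : H.1 \in unzip1 s by apply: map_f.
  move=> /ds; rewrite !inE eqxx H1 orbT => /(_ isT isT) e.
  by move: ps; rewrite e H1.
have := ha (p, n); rewrite inE eqxx ea => /(_ isT) /= pg.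
by apply: rdvdM (rdvd_refl _); apply: prime_exp_prod_cancel pg.
Qed.

End PrimeElements.

Lemma rdvd_polyXsubC (R : idomainType) (a : R) (p : {poly R}) :
  rdvd ('X - a%:P) p <-> p.[a] = 0.
Proof.
split=> [[q ->]|/eqP pa]; first by rewrite hornerM hornerXsubC subrr mulr0.
by have /factor_theorem : root p a by [].
Qed.

Lemma prime_polyXsubC (R : idomainType) (a : R) : prime_elt ('X - a%:P).
Proof.
split=> [/eqP|p q]; first by rewrite polyXsubC_eq0.
rewrite !rdvd_polyXsubC hornerM => /eqP.
by rewrite mulf_eq0 => /orP[] /eqP; [left|right].
Qed.

(** * Filtrations *)

(** Only closure rules are listed, so that powers of an ideal (decreasing in [a]) and degree bounds
    (increasing in [a]) are both instances. *)
Definition filtration (R : comNzRingType) (D : nat -> R -> Prop) : Prop :=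
  [/\ forall a, D a 0, D 0%N 1,
      forall a x y, D a x -> D a y -> D a (x - y)
    & forall a b x y, D a x -> D b y -> D (a + b)%N (x * y)].

Section Filtration.
Variables (R : comNzRingType) (D : nat -> R -> Prop).
Hypothesis fD : filtration D.

Lemma filtrationN a x : D a x -> D a (- x).
Proof. by case: fD => D0 _ DB _ Dx; rewrite -sub0r; apply: DB. Qed.

Lemma filtrationD a x y : D a x -> D a y -> D a (x + y).
Proof.
case: (fD) => D0 _ DB _ Dx Dy; rewrite -[y]opprK.
by apply: DB => //; apply: filtrationN.
Qed.

Lemma filtration_sum a I (s : seq I) (P : pred I) f :
  (forall i, P i -> D a (f i)) -> D a (\sum_(i <- s | P i) f i).
Proof.
case: (fD) => D0 _ _ _ h.
by apply: (big_ind (D a)) => //; apply: filtrationD.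
Qed.

Lemma filtration_prod I (s : seq I) (P : pred I) (a : I -> nat) f :
  (forall i, P i -> D (a i) (f i)) ->
  D (\sum_(i <- s | P i) a i) (\prod_(i <- s | P i) f i).
Proof.
case: fD => _ D1 _ DM h.
by apply: (big_ind2 D) => // a1 x1 a2 x2; apply: DM.
Qed.

Lemma filtration_exp a x n : D a x -> D (a * n)%N (x ^+ n).
Proof.
case: fD => _ D1 _ DM Dx; elim: n => [|n IH]; first by rewrite muln0.
by rewrite exprS mulnS; apply: DM.
Qed.

(* For [D a] the ideal generated by [c ^+ a], this is the filtration of
   [{poly R}] by the powers of the ideal ('X, c), provided [c] is regular. *)
Definition scaled (c : R) (a : nat) (p : {poly R}) : Prop :=
  forall n, D a (p`_n * c ^+ n).

Lemma scaled_filtration c : filtration (scaled c).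
Proof.
case: (fD) => D0 D1 DB DM; split.
- by move=> a n; rewrite coef0 mul0r.
- by case=> [|n]; rewrite coef1 ?mulr1 ?mul0r //; apply: D0.
- by move=> a p q Dp Dq n; rewrite coefB mulrBl; apply: DB.
- move=> a b p q Dp Dq n; rewrite coefM mulr_suml.
  apply: filtration_sum => i _; have -> : c ^+ n = c ^+ i * c ^+ (n - i).
    by rewrite -exprD subnKC // -ltnS.
  by rewrite mulrACA; apply: DM.
Qed.

Lemma scaled_XsubC (a : nat) (c d : R) :
  D a c -> D a d -> scaled d a ('X - c%:P).
Proof.
case: (fD) => D0 _ _ _ Dc Dd [|[|n]]; rewrite coefB coefX coefC /=.
- by rewrite sub0r mulr1; apply: filtrationN.
- by rewrite subr0 mul1r.
- by rewrite subr0 mul0r.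
Qed.

Lemma scaled_horner c a p : scaled c a p -> D a p.[c].
Proof. by move=> Dp; rewrite horner_coef; apply: filtration_sum. Qed.

End Filtration.

Definition dvd_filt (R : comNzRingType) (d : R) (a : nat) (x : R) : Prop :=
  rdvd (d ^+ a) x.

Lemma dvd_filtration (R : comNzRingType) (d : R) : filtration (dvd_filt d).
Proof.
split=> [a||a x y|a b x y]; rewrite /dvd_filt.
- exact: rdvd0.
- exact: rdvd1r.
- exact: rdvdB.
- by rewrite exprD; apply: rdvdM.
Qed.

(** [msize] is the total degree plus one, and 0 at the zero polynomial. *)
Definition deg_filt (F : idomainType) (l : nat) (a : nat) (x : {mpoly F[l]}) :
  Prop := (msize x <= a.+1)%N.

Lemma deg_filtration (F : idomainType) l : filtration (@deg_filt F l).
Proof.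
split=> [a||a x y|a b x y]; rewrite /deg_filt.
- by rewrite mmeasure0.
- by rewrite msize1.
- move=> hx hy; apply: leq_trans (mmeasureD_le _ _ _) _.
  by rewrite mmeasureN geq_max hx hy.
- have [->|x0] := eqVneq x 0; first by rewrite mul0r mmeasure0.
  have [->|y0] := eqVneq y 0; first by rewrite mulr0 mmeasure0.
  by rewrite msizeM //; lia.
Qed.

Definition size_filt (R : comNzRingType) (a : nat) (p : {poly R}) : Prop :=
  (size p <= a.+1)%N.

Lemma size_filtration (R : comNzRingType) : filtration (@size_filt R).
Proof.
split=> [a||a p q|a b p q]; rewrite /size_filt ?size_poly0 ?size_poly1 // => hp hq.
  by apply: leq_trans (size_polyD _ _) _; rewrite size_polyN geq_max hp hq.
by apply: leq_trans (size_polyMleq _ _) _; lia.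
Qed.

(** * Linear forms as prime elements of the polynomial ring *)

Section LinearForms.
Variables (F : fieldType) (l : nat).
Local Notation S := {mpoly F[l]}.
Implicit Types (p q : S) (i j : 'I_l).

Lemma mderivXU i j : mderiv i ('X_j : S) = (j == i)%:R.
Proof.
rewrite mderivX mnm1E; case: eqP => [->|_]; last by rewrite scale0r.
suff -> : (U_(i) - U_(i) = 0)%MM by rewrite mpolyX0 scale1r.
by apply/mnmP => k; rewrite mnmBE subnn mnm0E.
Qed.

(** The substitution of [q] for ['X_i]. When it fixes [q], its kernel is the ideal generated by
    ['X_i - q], which turns divisibility by a linear form into an evaluation. *)
Definition subst_var i q : S -> S :=
  mmap (@mpolyC l F) (fun k => if k == i then q else 'X_k).

HB.instance Definition _ i q := GRing.RMorphism.on (subst_var i q).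

Lemma subst_varX i q j : subst_var i q 'X_j = if j == i then q else 'X_j.
Proof. by rewrite /subst_var mmapX mmap1U. Qed.

(** The identity xy - x'y' = x(y - y') + y'(x - x') reduces the congruence to powers of single
    variables. *)
Lemma rdvd_sub_subst i q p : rdvd ('X_i - q) (p - subst_var i q p).
Proof.
elim/mpolyind: p => [|c m p _ _ IH]; first by rewrite rmorph0 subr0; apply: rdvd0.
rewrite rmorphD /= opprD addrACA; apply: rdvdD IH.
rewrite -mul_mpolyC rmorphM /= {1}/subst_var mmapC -mulrBr; apply: rdvdMl.
rewrite (mpolyXE_id _ m) rmorph_prod /=.
apply: (big_ind2 (fun x y => rdvd ('X_i - q) (x - y))) => [|x x' y y' hx hy|j _].
- by rewrite subrr; apply: rdvd0.
- have -> : x * y - x' * y' = x * (y - y') + y' * (x - x') by ring.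
  by apply: rdvdD; apply: rdvdMl.
- rewrite rmorphXn subrXX /= subst_varX; apply: rdvdMr.
  by case: eqP => [->|_]; rewrite ?subrr; [apply: rdvd_refl|apply: rdvd0].
Qed.

Lemma rdvd_XsubU i q p : subst_var i q q = q ->
  rdvd ('X_i - q) p <-> subst_var i q p = 0.
Proof.
move=> hq; split=> [[g ->]|p0].
  by rewrite rmorphM rmorphB /= subst_varX eqxx hq subrr mulr0.
by rewrite -[p]subr0 -p0; apply: rdvd_sub_subst.
Qed.

(** The ideal of multiples of ['X_i - q] is the kernel of a morphism into a domain. *)
Lemma prime_XsubU i q : 'X_i - q != 0 -> subst_var i q q = q ->
  prime_elt ('X_i - q).
Proof.
move=> /eqP nz hq; split=> // f g; rewrite !rdvd_XsubU // rmorphM.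
by move=> /eqP; rewrite mulf_eq0 => /orP[] /eqP; [left|right].
Qed.

Lemma subst_varZX i j z : j != i -> subst_var i (z *: 'X_j) 'X_j = 'X_j.
Proof. by move=> ji; rewrite subst_varX (negbTE ji). Qed.

Lemma subst_varZZX i j z : j != i ->
  subst_var i (z *: 'X_j) (z *: 'X_j) = z *: 'X_j.
Proof.
by move=> ji; rewrite {1}/subst_var mmapZ mul_mpolyC -/(subst_var _ _ _) subst_varZX.
Qed.

Lemma mpolyXU_neq0 i : 'X_i != 0 :> S.
Proof. by rewrite -msize_poly_eq0 msizeX. Qed.

Lemma msizeXUn i n : msize ('X_i ^+ n : S) = n.+1.
Proof. by rewrite mpolyXn msizeX mdegMn mdeg1 mul1n. Qed.

Lemma diff_form_neq0 i j z : i != j -> 'X_i - z *: 'X_j != 0 :> S.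
Proof.
move=> ij; apply/eqP => /(congr1 (fun p => p@_U_(i))) /eqP.
rewrite mcoeffB mcoeffZ !mcoeffXU mcoeff0 eqxx (eq_sym j) (negbTE ij) mulr0 subr0.
by rewrite oner_eq0.
Qed.

Lemma prime_diff_form i j z : i != j -> prime_elt ('X_i - z *: 'X_j : S).
Proof.
move=> ij; apply: prime_XsubU; first exact: diff_form_neq0.
by apply: subst_varZZX; rewrite eq_sym.
Qed.

Lemma diff_form_ndvdXr i j z : i != j -> ~ rdvd ('X_i - z *: 'X_j : S) 'X_j.
Proof.
rewrite eq_sym => ij; rewrite rdvd_XsubU ?subst_varZZX // subst_varZX //.
exact/eqP/mpolyXU_neq0.
Qed.

Lemma diff_form_ndvdXl i j z : i != j -> z != 0 ->
  ~ rdvd ('X_i - z *: 'X_j : S) 'X_i.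
Proof.
rewrite eq_sym => ij z0; rewrite rdvd_XsubU ?subst_varZZX // subst_varX eqxx.
by apply/eqP; rewrite scaler_eq0 (negbTE z0) (negbTE (mpolyXU_neq0 j)).
Qed.

Lemma prime_XU i : prime_elt ('X_i : S).
Proof.
rewrite -['X_i]subr0; apply: prime_XsubU; last exact: rmorph0.
by rewrite subr0 mpolyXU_neq0.
Qed.

Lemma XUexp_inj n : (0 < n)%N -> injective (fun i => 'X_i ^+ n : S).
Proof.
move=> n0 i j /(congr1 (subst_var i 0)); rewrite !rmorphXn /= !subst_varX eqxx.
case: eqP => [-> //|_] /esym/eqP.
by rewrite expr0n gtn_eqF // expf_eq0 (negbTE (mpolyXU_neq0 j)) andbF.
Qed.

End LinearForms.

(** * Integration in the variable [t ^+ r] *)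

Section WeightedIntegral.
Variables (F : numFieldType) (l r m kap : nat).
Hypothesis r_gt1 : (1 < r)%N.
Local Notation S := {mpoly F[l]}.

(* With kap = k + 1 + m, integrating t^(r(k+1)) t^(rs) produces the
   denominator r(k+1+s) + 1. *)
Definition int_denom (s : nat) : F :=
  (r * (kap + s) + 1)%N%:R - (r * m)%N%:R.

(** The denominator is 1 modulo [r], so the exponent -1 is never integrated. *)
Lemma int_denom_neq0 s : int_denom s != 0.
Proof.
rewrite /int_denom subr_eq0 eqr_nat; apply/eqP => /(congr1 (modn^~ r)).
by rewrite !(mulnC r) modnMDl modnMl modn_small.
Qed.

(** With T = t^r and k + 1 = kap - m, the antiderivative of t^(r(k+1)) p(T) is t^(r(k+1)+1) times
    [wint p] at T. *)
Definition wint (p : {poly S}) : {poly S} :=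
  \poly_(s < size p) ((int_denom s)^-1 *: p`_s).

Lemma coef_wint p s : (wint p)`_s = (int_denom s)^-1 *: p`_s.
Proof.
by rewrite coef_poly; case: ltnP => // h; rewrite nth_default // scaler0.
Qed.

Lemma size_wint p : (size (wint p) <= size p)%N.
Proof. exact: size_poly. Qed.

Lemma wint_sum I (s : seq I) (c : I -> S) (p : I -> {poly S}) :
  wint (\sum_(i <- s) c i *: p i) = \sum_(i <- s) c i *: wint (p i).
Proof.
apply/polyP => n; rewrite coef_wint !coef_sum scaler_sumr; apply: eq_bigr => i _.
by rewrite !coefZ coef_wint scalerAr.
Qed.

Lemma wint_eq0 p : wint p = 0 -> p = 0.
Proof.
move=> /polyP e; apply/polyP => s; have /eqP := e s.
rewrite coef_wint !coef0 scaler_eq0 invr_eq0 (negbTE (int_denom_neq0 s)).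
by move/eqP.
Qed.

(** On T^s the left side multiplies by rs + r kap + 1 - rm, which is [int_denom s]. The constant
    r(kap - m) + 1 may be negative, hence its split into two natural multiples. *)
Lemma wint_ode p :
  ('X * (wint p)^`()) *+ r + wint p *+ (r * kap + 1) - wint p *+ (r * m) = p.
Proof.
apply/polyP => s; rewrite !(coefD, coefN, coefMn) coefXM coef_deriv.
have -> : (if s == 0%N then 0 else (wint p)`_s.-1.+1 *+ s.-1.+1) =
  (wint p)`_s *+ s by case: s => //=.
rewrite coef_wint -mulrnA -mulrnDr -!scaler_nat -scalerBl scalerA.
suff -> : (s * r + (r * kap + 1))%N%:R - (r * m)%:R = int_denom s.
  by rewrite mulfV ?int_denom_neq0 // scale1r.
by rewrite /int_denom; congr (_%:R - _); lia.
Qed.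

(** Coefficient s of the equation gives b(s+1)f_{s+1} = h_s - (s - B)f_s, where h is the right-hand
    side. After multiplication by d^(s+1), induction from f_0 = 0 shows that d^(N+1) divides each
    f_s d^s: [b] cancels by assumption and s+1 is invertible in characteristic 0. *)
Lemma taylor_order (b d : S) (B N : nat) (f : {poly S}) :
  (forall n g, rdvd (d ^+ n) (b * g) -> rdvd (d ^+ n) g) -> f`_0 = 0 ->
  scaled (dvd_filt d) d N (('X + b%:P) * f^`() - f *+ B) ->
  rdvd (d ^+ N.+1) f.[d].
Proof.
move=> bP f0 h; apply: (scaled_horner (dvd_filtration d)).
elim=> [|s IH]; rewrite /dvd_filt; first by rewrite f0 mul0r; apply: rdvd0.
apply: bP; have := h s; rewrite /dvd_filt mulrDl coefB coefD coefCM coefMn.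
have -> : ('X * f^`())`_s = f`_s *+ s by rewrite coefXM coef_deriv; case: s {IH}.
rewrite coef_deriv => /(fun h => rdvdM h (rdvd_refl d)).
rewrite -exprSr => hs.
have e : (b * (f`_s.+1 * d ^+ s.+1)) *+ s.+1 =
    (f`_s *+ s + b * (f`_s.+1 *+ s.+1) - f`_s *+ B) * d ^+ s * d
  - (s%:R - B%:R) * d * (f`_s * d ^+ s).
  rewrite exprSr; move: (f`_s) (f`_s.+1) (d ^+ s) => u0 u1 ds.
  by ring.
have : rdvd (d ^+ N.+1) ((b * (f`_s.+1 * d ^+ s.+1)) *+ s.+1).
  by rewrite e; apply: rdvdB hs _; apply: rdvdMl.
move=> [g eg]; exists (s.+1%:R^-1 *: g).
rewrite -scalerAl -eg -scaler_nat scalerA mulVf ?scale1r //.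
by rewrite pnatr_eq0.
Qed.

Lemma XderivXn n : 'X * ('X^n)^`() = 'X^n *+ n :> {poly S}.
Proof. by rewrite derivXn; case: n => [|n]; rewrite ?mulr0 // mulrnAr -exprS. Qed.

(** The substitution T = t^r turns r T d/dT into t d/dt, and the factor t^(r kap + 1) absorbs the
    positive part of the constant term. *)
Lemma wint_comp_ode p :
  'X * ('X^(r * kap + 1) * (wint p \Po 'X^r))^`()
    - ('X^(r * kap + 1) * (wint p \Po 'X^r)) *+ (r * m) =
  'X^(r * kap + 1) * (p \Po 'X^r).
Proof.
have /(congr1 (comp_poly 'X^r)) := wint_ode p.
rewrite comp_polyB comp_polyD !(raddfMn (comp_poly _)) /= comp_polyM comp_polyX => <-.
rewrite derivM deriv_comp mulrDr mulrA XderivXn.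
have -> : 'X * ('X^(r * kap + 1) * (((wint p)^`() \Po 'X^r) * ('X^r)^`())) =
    'X^(r * kap + 1) * (((wint p)^`() \Po 'X^r) * 'X^r) *+ r :> {poly S}.
  rewrite -mulrnAr -mulrnAr -XderivXn.
  by move: 'X^(r * kap + 1) (_ \Po _) ('X^r)^`() => a c e; ring.
move: ('X^r) ((wint p)^`() \Po _) (wint p \Po _) => a c e.
by move: ('X^_) => u; ring.
Qed.

(* With G(u) the integral from b to u, [f] below is (u b)^(rm) G(u), which
   clears the denominators of G. *)
Lemma wint_order (x b : S) (p : {poly S}) (N : nat) :
  (forall n g, rdvd ((x - b) ^+ n) (b * g) -> rdvd ((x - b) ^+ n) g) ->
  scaled (dvd_filt (x - b)) (x - b) N (p \Po ('X + b%:P) ^+ r) ->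
  rdvd ((x - b) ^+ N.+1)
    (x ^+ (r * kap + 1) * b ^+ (r * m) * (wint p).[x ^+ r]
     - b ^+ (r * kap + 1) * x ^+ (r * m) * (wint p).[b ^+ r]).
Proof.
move=> bP hp.
pose f : {poly S} := (b ^+ (r * m))%:P * ('X^(r * kap + 1) * (wint p \Po 'X^r))
  - (b ^+ (r * kap + 1) * (wint p).[b ^+ r])%:P * 'X^(r * m).
have fE u : f.[u] = u ^+ (r * kap + 1) * b ^+ (r * m) * (wint p).[u ^+ r]
     - b ^+ (r * kap + 1) * u ^+ (r * m) * (wint p).[b ^+ r].
  rewrite /f hornerD hornerN !hornerM !hornerC !hornerXn horner_comp hornerXn.
  by rewrite mulrCA !mulrA [in X in _ - X]mulrAC.
have f_ode : 'X * f^`() - f *+ (r * m) =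
    (b ^+ (r * m))%:P * ('X^(r * kap + 1) * (p \Po 'X^r)).
  rewrite -wint_comp_ode /f derivB !(derivM _%:P) !derivC !mul0r !add0r mulrBr.
  rewrite [X in _ - X - _]mulrCA XderivXn.
  move: (_ * (_ \Po _)) => a; move: (a^`()) => a'.
  move: ('X^_) (_%:P) (_%:P) => u c e; ring.
(* Recentring at [b] makes the Taylor coefficients at [b] ordinary coefficients and moves the
   endpoint [x] to [x - b]. *)
clearbody f; pose g := f \Po ('X + b%:P).
have gE u : g.[u] = f.[u + b] by rewrite /g horner_comp !hornerE.
rewrite -fE; have -> : f.[x] = g.[x - b] by rewrite gE subrK.
apply: (@taylor_order b _ (r * m) N g bP).
  by rewrite -horner_coef0 gE add0r fE mulrAC subrr.
have -> : ('X + b%:P) * g^`() - g *+ (r * m) =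
    ((b ^+ (r * m))%:P * ('X + b%:P) ^+ (r * kap + 1))
    * (p \Po ('X + b%:P) ^+ r).
  rewrite /g deriv_comp derivD derivX derivC addr0 mulr1.
  have -> : ('X + b%:P) * (f^`() \Po ('X + b%:P)) =
     ('X * f^`()) \Po ('X + b%:P) by rewrite comp_polyM comp_polyX.
  rewrite -rmorphMn -rmorphB /= f_ode !comp_polyM comp_polyC -comp_polyA.
  by rewrite !comp_Xn_poly mulrA.
rewrite -[N]add0n; have [_ _ _ fM] := scaled_filtration (dvd_filtration (x - b)) (x - b).
by apply: fM hp => n; apply: rdvd1r.
Qed.

End WeightedIntegral.

(** * The coefficient matrix *)

Section ProductPolynomials.
Variables (F : numFieldType) (l r m : nat).
Hypotheses (r_gt1 : (1 < r)%N) (m_gt0 : (0 < m)%N).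
Local Notation S := {mpoly F[l]}.
Implicit Types i j k : 'I_l.

(* lambda(t)^(m-1) lambda_i(t) as a polynomial in t^r. *)
Definition lam_poly i : {poly S} :=
  \prod_(j < l) ('X - ('X_j ^+ r)%:P) ^+ (m - (j == i)).

Lemma sum_lam_exp i : (\sum_(j < l) (m - (j == i)) = l * m - 1)%N.
Proof.
rewrite (bigD1 i) //= eqxx.
under eq_bigr => j ji do rewrite (negbTE ji) subn0.
rewrite sum_nat_const cardC1 card_ord; case: l i => [[]//|l' _].
by case: m m_gt0 => // m' _; rewrite mulSn subn1 subSS subn0.
Qed.

Lemma lam_polyE i : lam_poly i =
  (\prod_(j < l) ('X - ('X_j ^+ r)%:P)) ^+ (m - 1)
  * \prod_(j < l | j != i) ('X - ('X_j ^+ r)%:P).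
Proof.
rewrite /lam_poly (bigD1 i) //= eqxx [in RHS](bigD1 i) //= exprMn -mulrA.
congr (_ * _); rewrite -prodrXl -big_split /=; apply: eq_bigr => j ji.
by rewrite (negbTE ji) subn0 -exprSr subn1 prednK.
Qed.

Lemma size_lam_poly i : (size (lam_poly i) <= l * m)%N.
Proof.
have lm : (0 < l * m)%N by rewrite muln_gt0 m_gt0 andbT; case: l i => [[]|].
have : size_filt (\sum_(j < l) (m - (j == i))) (lam_poly i).
  apply: (filtration_prod (@size_filtration S)) => j _.
  rewrite -[X in size_filt X]mul1n.
  by apply: (filtration_exp (@size_filtration S)); rewrite /size_filt size_XsubC.
by rewrite /size_filt sum_lam_exp subn1 prednK.
Qed.

(** Scaling by ['X_k ^+ r] gives T the weight r, for which each factor T - x_j^r has degree r. *)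
Lemma lam_poly_scaled_deg i k :
  scaled (@deg_filt F l) ('X_k ^+ r) (r * (l * m - 1)) (lam_poly i).
Proof.
have fD := @deg_filtration F l; have fS := scaled_filtration fD ('X_k ^+ r).
rewrite -(sum_lam_exp i) big_distrr /=; apply: (filtration_prod fS) => j _.
apply: (filtration_exp fS).
by apply: scaled_XsubC => //; rewrite /deg_filt msizeXUn.
Qed.

(** The factor T - x_k^r lies in the ideal (T, x_k^r), and it occurs m - [k = i] times. *)
Lemma lam_poly_scaled_dvd i k :
  scaled (dvd_filt ('X_k ^+ r : S)) ('X_k ^+ r) (m - (k == i)) (lam_poly i).
Proof.
have fD := dvd_filtration ('X_k ^+ r : S).
have fS := scaled_filtration fD ('X_k ^+ r).
rewrite /lam_poly (bigD1 k) //= -[X in scaled _ _ X]addn0.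
have [_ _ _ DM] := fS; apply: DM; last by move=> n; apply: rdvd1r.
rewrite -[X in scaled _ _ X]mul1n; apply: (filtration_exp fS).
by apply: scaled_XsubC => //; apply: rdvd_refl.
Qed.

Lemma scaled_dvd_le (d : S) a b (p : {poly S}) : (a <= b)%N ->
  scaled (dvd_filt d) d b p -> scaled (dvd_filt d) d a p.
Proof. by move=> ab h n; apply: rdvd_trans (h n); apply: rdvd_exp2l. Qed.

(* Both factors t^r - x_j^r and t^r - x_k^r of lambda vanish at the endpoints
   of integration, and lambda_i lacks at most one of them. *)
Lemma lam_poly_scaled_diff i j k (b : S) : j != k -> b ^+ r = 'X_k ^+ r ->
  scaled (dvd_filt ('X_j - b)) ('X_j - b) (2 * m - 1)
    (lam_poly i \Po ('X + b%:P) ^+ r).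
Proof.
move=> jk br; set d := 'X_j - b; set q := ('X + b%:P) ^+ r.
have fD := dvd_filtration d; have fS := scaled_filtration fD d.
have [_ _ _ DM] := fS.
(* (X + b)^r - c^r is a multiple of X + b - c, which lies in the ideal (X, d). It is used with c =
   x_j and with c = b. *)
have factor t (c : S) : rdvd d (c - b) -> c ^+ r = 'X_t ^+ r ->
    scaled (dvd_filt d) d (m - (t == i))
      (('X - ('X_t ^+ r)%:P) ^+ (m - (t == i)) \Po q).
  move=> dc <-; set n := (m - _)%N.
  rewrite (rmorphXn (comp_poly q)) /= comp_polyB comp_polyX comp_polyC polyC_exp subrXX.
  rewrite -[X in scaled _ _ X]mul1n; apply: (filtration_exp fS).
  rewrite -[1%N]addn0; apply: (DM); last by move=> s; apply: rdvd1r.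
  rewrite -addrA -opprB -polyCB; apply: scaled_XsubC => //.
  by rewrite /dvd_filt expr1; apply: rdvd_refl.
rewrite /lam_poly rmorph_prod /= (bigD1 j) // (bigD1 k) /=; last by rewrite eq_sym.
apply: (@scaled_dvd_le _ _ ((m - (j == i)) + ((m - (k == i)) + 0))).
  by move: jk; have [->|_] := eqVneq j i; [rewrite eq_sym|]; lia.
apply: (DM); first by apply: (factor j 'X_j) => //; apply: rdvd_refl.
apply: DM; first by apply: (factor k b) => //; rewrite subrr; apply: rdvd0.
by move=> s; apply: rdvd1r.
Qed.

End ProductPolynomials.

(** The equation of [wint_ode] for W = g q^(s+1) with q' = 1, divided by q^s: only the derivative of
    the power of [q] leaves a term without the factor [q]. *)
Lemma ode_cancel (A : idomainType) (x g g' h q : A) (r s a b : nat) : q != 0 ->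
  (x * (g' * q ^+ s.+1 + g * (q ^+ s *+ s.+1))) *+ r
    + (g * q ^+ s.+1) *+ a - (g * q ^+ s.+1) *+ b = h * q ^+ s.+1 ->
  (x * g) *+ (s.+1 * r) = (h - (x * g') *+ r - g *+ a + g *+ b) * q.
Proof.
move=> q0 e; apply: (mulIf (expf_neq0 s q0)); rewrite -mulrA -exprS.
rewrite mulrDl !mulrBl -e exprS mulrnA; move: (q ^+ s) s.+1 => qs s1; ring.
Qed.

Section CoefficientMatrix.
Variables (F : numFieldType) (l r m kap : nat) (mb mu : 'I_l -> nat).
Hypotheses (r_gt1 : (1 < r)%N) (m_gt0 : (0 < m)%N).
Hypotheses (mb_le : forall i, (mb i <= r - 1)%N)
           (muE : forall i, (mu i + r = r * kap + 1 + mb i)%N).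
Local Notation S := {mpoly F[l]}.
Local Notation P := (@lam_poly F l r m).
Local Notation W i := (wint r m kap (P i)).
Implicit Types i j k : 'I_l.

Lemma wint_lam_dvd i j : rdvd (('X_j ^+ r) ^+ (m - (j == i))) (W i).['X_j ^+ r : S].
Proof.
apply: (scaled_horner (dvd_filtration ('X_j ^+ r : S))) => s.
rewrite coef_wint -scalerAl -mul_mpolyC.
by apply: rdvdMl; apply: lam_poly_scaled_dvd.
Qed.

(** The coefficients of x_i^(mb i) sigma_i are polynomials: the powers of x_j dividing W_i(x_j^r)
    compensate the denominator x_j^(rm). *)
Lemma coef_matrix_exists : exists theta : 'M[S]_l,
  (forall i j, theta i j * 'X_j ^+ (r * m) =
     'X_i ^+ mb i * 'X_j ^+ (r * kap + 1) * (W i).['X_j ^+ r]) /\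
  (forall i j, rdvd ('X_j ^+ mu j) (theta i j)).
Proof.
have [f fP] : exists f : 'I_l * 'I_l -> S, forall ij,
    (W ij.1).['X_ij.2 ^+ r] = f ij * ('X_ij.2 ^+ r) ^+ (m - (ij.2 == ij.1)).
  apply: (@fin_all_exists _ (fun=> S) (fun ij v =>
    (W ij.1).['X_ij.2 ^+ r] = v * ('X_ij.2 ^+ r) ^+ (m - (ij.2 == ij.1)))).
  by move=> [i j]; apply: wint_lam_dvd.
(* On the diagonal only x_i^(r(m-1)) divides W_i(x_i^r), leaving the exponent mb i + r kap + 1 - r =
   mu i. Off it, r kap + 1 already exceeds mu j because mb j < r. *)
exists (\matrix_(i, j) (if j == i then 'X_i ^+ mu i * f (i, i)
                        else 'X_i ^+ mb i * 'X_j ^+ (r * kap + 1) * f (i, j))).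
split=> i j; rewrite mxE; have := fP (i, j); rewrite /=.
  have [-> ->|ji ->] := eqVneq j i.
    rewrite -exprM -exprD mulrAC -exprD [RHS]mulrCA -exprD mulrC.
    congr (_ * 'X_i ^+ _); have := muE i; rewrite mulnBr muln1.
    by have := leq_pmulr r m_gt0; lia.
  by rewrite subn0 -exprM mulrA.
case: eqVneq => [-> _|ji _]; first by apply: rdvdMr; apply: rdvd_refl.
apply/rdvdMr/rdvdMl/rdvd_exp2l.
by have := muE j; have := mb_le j; lia.
Qed.

Variable theta : 'M[S]_l.
Hypothesis thetaE : forall i j, theta i j * 'X_j ^+ (r * m) =
     'X_i ^+ mb i * 'X_j ^+ (r * kap + 1) * (W i).['X_j ^+ r].

(** All exponents of the antiderivative are 1 modulo [r], so it commutes with multiplication of its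
    argument by [z]. The difference is therefore x_i^(mb i) times an integral from z x_k to x_j, and
    [wint_order] applies. *)
Lemma coef_matrix_diff i j k z : j != k -> z ^+ r = 1 ->
  rdvd (('X_j - z *: 'X_k) ^+ (2 * m)) (theta i j - z *: theta i k).
Proof.
move=> jk zr; set b : S := z *: 'X_k; set d := 'X_j - b.
have r_gt0 := ltnW r_gt1.
have z0 : z != 0.
  by apply: contra_eq_neq zr => ->; rewrite expr0n gtn_eqF // eq_sym oner_neq0.
have dP : prime_elt d by apply: prime_diff_form.
have ndj : ~ rdvd d 'X_j by apply: diff_form_ndvdXl.
have ndk : ~ rdvd d 'X_k by apply: diff_form_ndvdXr.
have br : b ^+ r = 'X_k ^+ r by rewrite exprZn zr scale1r.
have brm : b ^+ (r * m) = 'X_k ^+ (r * m) by rewrite !exprM br.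
have brk : b ^+ (r * kap + 1) = z *: 'X_k ^+ (r * kap + 1).
  by rewrite !exprD !exprM br !expr1 /b scalerAr.
have bP n g : rdvd (d ^+ n) (b * g) -> rdvd (d ^+ n) g.
  apply: prime_expM_cancel dP _ => -[h e]; apply: ndk; exists (z^-1 *: h).
  by rewrite -scalerAl -e scalerA mulVf // scale1r.
have m2 : (2 * m - 1).+1 = (2 * m)%N by lia.
have := wint_order m kap r_gt1 bP (lam_poly_scaled_diff r_gt1 m_gt0 i jk br).
rewrite m2 brm brk br -/d => /(rdvdMl ('X_i ^+ mb i)) h.
(* The denominators x_j^(rm) and x_k^(rm) are restored; the prime [d] divides neither variable. *)
apply: (prime_expX_cancel (k := r * m) dP ndj).
apply: (prime_expX_cancel (k := r * m) dP ndk).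
suff -> : 'X_k ^+ (r * m) * ('X_j ^+ (r * m) * (theta i j - z *: theta i k)) =
  'X_i ^+ mb i * ('X_j ^+ (r * kap + 1) * 'X_k ^+ (r * m) * (W i).['X_j ^+ r] -
      z *: 'X_k ^+ (r * kap + 1) * 'X_j ^+ (r * m) * (W i).['X_k ^+ r]) by [].
have := thetaE i j; have := thetaE i k; rewrite -!(mul_mpolyC z).
move: (theta i j) (theta i k) (W i).[_] (W i).[_] => tj tk wj wk.
move: ('X_k ^+ (r * m)) ('X_j ^+ (r * m)) ('X_k ^+ (r * kap + 1)).
move: ('X_j ^+ (r * kap + 1)) ('X_i ^+ mb i).
move: z%:MP => zc vj w uk uj vk ek ej.
have -> : uk * (uj * (tj - zc * tk)) = uk * (tj * uj) - zc * (uj * (tk * uk)).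
  by ring.
by rewrite ek ej; ring.
Qed.

Lemma coef_matrix_deg i j :
  deg_filt (mb i + r * kap + 1 + r * (l * m - 1) - r * m) (theta i j).
Proof.
have fD := @deg_filtration F l; have [_ _ _ DM] := fD.
have dX k n : deg_filt n ('X_k ^+ n : S) by rewrite /deg_filt msizeXUn.
have /= : deg_filt (mb i + (r * kap + 1) + r * (l * m - 1))
    (theta i j * 'X_j ^+ (r * m)).
  rewrite thetaE; apply: (DM); first by apply: (DM).
  apply: (scaled_horner fD) => s; rewrite coef_wint -scalerAl.
  by apply: leq_trans (msizeZ_le _ _) _; apply: lam_poly_scaled_deg.
rewrite /deg_filt; have [->|t0] := eqVneq (theta i j) 0.
  by rewrite mmeasure0.
rewrite msizeM ?msizeXUn //; last by rewrite -msize_poly_eq0 msizeXUn.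
by rewrite addnS /=; lia.
Qed.

(** The order of vanishing rises by one at a time: if W = g q^(s+1) with s+1 < m, the equation at
    [y] leaves r(s+1) y g(y) = 0, and [y] is nonzero. *)
Lemma wint_XsubC_dvd (y : S) (p : {poly S}) : y != 0 ->
  rdvd (('X - y%:P) ^+ (m - 1)) p -> (wint r m kap p).[y] = 0 ->
  rdvd (('X - y%:P) ^+ m) (wint r m kap p).
Proof.
move=> y0 [p' ep] Wy; set q := 'X - y%:P.
have := wint_ode m kap r_gt1 p; move: (wint r m kap p) Wy => w Wy ode.
have q0 : q != 0 by rewrite polyXsubC_eq0.
suff h s : (s < m)%N -> rdvd (q ^+ s.+1) w.
  by have := h m.-1; rewrite prednK // leqnn; apply.
elim: s => [_|s IH sm].
  by rewrite expr1; apply/rdvd_polyXsubC.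
have [g eg] := IH (ltnW sm).
have [h ep2] : rdvd (q ^+ s.+1) p.
  by rewrite ep; apply/rdvdMl/rdvd_exp2l; lia.
move: ode; rewrite eg derivM deriv_exp ep2 derivXsubC mul1r /= => e.
have {}e : ('X * g) *+ (s.+1 * r) =
    (h - ('X * g^`()) *+ r - g *+ (r * kap + 1) + g *+ (r * m)) * q.
  exact: ode_cancel e.
have /eqP := congr1 (horner^~ y) e.
rewrite hornerMn !hornerM hornerX hornerXsubC subrr mulr0 -(@scaler_nat F).
rewrite scaler_eq0 pnatr_eq0 muln_eq0 (gtn_eqF (ltnW r_gt1)) mulf_eq0.
rewrite (negbTE y0) /=.
move=> /eqP/rdvd_polyXsubC[g1 eg1].
by exists g1; rewrite eg1 [in RHS]exprS mulrA.
Qed.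

(** W would have l distinct roots x_j^r of multiplicity m, hence be a multiple of a monic polynomial
    of degree lm, while its degree is below lm. *)
Lemma wint_eq0_of_roots (p : {poly S}) : (size p <= l * m)%N ->
  (forall j, rdvd (('X - ('X_j ^+ r)%:P) ^+ (m - 1)) p) ->
  (forall j, (wint r m kap p).['X_j ^+ r] = 0) -> p = 0.
Proof.
move=> sp dp Wp; apply: (wint_eq0 r_gt1 (m := m) (kap := kap)).
apply/eqP; apply/negPn/negP => w0.
pose y j : S := 'X_j ^+ r; have r_gt0 := ltnW r_gt1.
have y_neq0 j : y j != 0 by rewrite expf_neq0 // mpolyXU_neq0.
have XsubC_dvd (a b : S) : rdvd ('X - a%:P) ('X - b%:P) -> a = b.
  by rewrite rdvd_polyXsubC hornerXsubC => /eqP; rewrite subr_eq0 => /eqP.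
have XsubC_inj : injective (fun j => 'X - (y j)%:P).
  by move=> i j /addrI/oppr_inj/polyC_inj/(XUexp_inj r_gt0).
pose s := [seq ('X - (y j)%:P, m) | j <- enum 'I_l].
have s1 : unzip1 s = [seq 'X - (y j)%:P | j <- enum 'I_l].
  by rewrite /unzip1 -map_comp.
have : rdvd (\prod_(H <- s) H.1 ^+ H.2) (wint r m kap p).
  apply: rdvd_prod_prime_exp; rewrite ?s1.
  - by rewrite (map_inj_uniq XsubC_inj) enum_uniq.
  - by move=> q /mapP[j _ ->]; apply: prime_polyXsubC.
  - by move=> q q' /mapP[i _ ->] /mapP[j _ ->] /XsubC_dvd ->.
  - move=> H /mapP[j _ ->] /=.
    exact: wint_XsubC_dvd (y_neq0 j) (dp j) (Wp j).
rewrite big_map /= prodrXl big_enum /= => -[g eg].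
have pm : (\prod_(j < l) ('X - (y j)%:P)) ^+ m \is monic.
  by apply/rpredX/monic_prod_XsubC.
have g0 : g != 0 by apply: contra_neq w0 => g0; rewrite eg g0 mul0r.
have := leq_trans (size_wint r m kap p) sp; rewrite eg size_Mmonic //.
have := monic_neq0 pm; rewrite -size_poly_gt0; have := g0; rewrite -size_poly_gt0.
have := size_exp (\prod_(j < l) ('X - (y j)%:P)) m.
have sz : size (index_enum 'I_l) = l by rewrite /index_enum unlock -enumT size_enum_ord.
by rewrite size_prod_XsubC sz /=; move: (size _) (size _) (l * m)%N => a b n; lia.
Qed.

Lemma coef_matrix_free (c : 'I_l -> S) :
  (forall j, \sum_i c i * theta i j = 0) -> forall i, c i = 0.
Proof.
move=> ct; have r_gt0 := ltnW r_gt1.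
pose p := \sum_i (c i * 'X_i ^+ mb i) *: P i.
pose Lam : {poly S} := \prod_(j < l) ('X - ('X_j ^+ r)%:P).
have pE : p = Lam ^+ (m - 1) *
    \sum_i (c i * 'X_i ^+ mb i) *: \prod_(j < l | j != i) ('X - ('X_j ^+ r)%:P).
  rewrite mulr_sumr; apply: eq_bigr => i _.
  by rewrite lam_polyE // scalerAr.
have p0 : p = 0.
  apply: wint_eq0_of_roots => [|j|j].
  - apply: leq_trans (size_sum _ _ _) _; apply/bigmax_leqP => i _.
    by apply: leq_trans (size_scale_leq _ _) _; apply: size_lam_poly.
  - rewrite pE; apply: rdvdMr; rewrite /Lam (bigD1 j) //= exprMn.
    by apply: rdvdMr; apply: rdvd_refl.
  - have x0 n : 'X_j ^+ n != 0 :> S by rewrite expf_neq0 // mpolyXU_neq0.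
    (* Up to nonzero powers of x_j, the value of W at x_j^r is the j-th component of the given
       relation. *)
    apply: (mulfI (x0 (r * kap + 1)%N)); rewrite mulr0 wint_sum horner_sum.
    transitivity ((\sum_i c i * theta i j) * 'X_j ^+ (r * m)).
      rewrite mulr_sumr mulr_suml; apply: eq_bigr => i _.
      by rewrite -[in RHS]mulrA thetaE hornerZ mulrCA !mulrA.
    by rewrite ct mul0r.
have Lam0 : Lam != 0 by apply/prodf_neq0 => j _; rewrite polyXsubC_eq0.
move=> i; apply/eqP; move/eqP: p0; rewrite pE mulf_eq0 expf_eq0 (negbTE Lam0) andbF /=.
(* As in Lagrange interpolation, evaluation at x_i^r kills every term but the i-th. *)
move=> /eqP/(congr1 (horner^~ ('X_i ^+ r))); rewrite horner_sum horner0.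
rewrite (bigD1 i) //= [X in _ + X]big1 => [|k ki]; last first.
  rewrite hornerZ horner_prod (bigD1 i) /=; last by rewrite eq_sym.
  by move: (c k * _) (\prod_(_ < l | _) _) => u v; rewrite hornerXsubC subrr mul0r mulr0.
rewrite addr0 hornerZ horner_prod => /eqP; rewrite !mulf_eq0 expf_eq0.
rewrite (negbTE (mpolyXU_neq0 _ i)) andbF orbF => /orP[//|/eqP e].
suff /eqP : \prod_(j < l | j != i) ('X - ('X_j ^+ r)%:P).['X_i ^+ r : S] != 0 by [].
apply/prodf_neq0 => j ji; rewrite hornerXsubC subr_eq0.
by apply: contra ji => /eqP/(XUexp_inj r_gt0) ->.
Qed.

Lemma coef_matrix_det : \det theta != 0.
Proof.
apply/negP => /det0P[v v0 vt]; move/negP: v0; apply.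
apply/eqP/rowP => i; rewrite mxE; apply: (coef_matrix_free (c := v 0)) => j.
by have /rowP/(_ j) := vt; rewrite !mxE.
Qed.

End CoefficientMatrix.

(** * Saito's criterion *)

Section Saito.
Variables (F : fieldType) (l : nat).
Local Notation S := {mpoly F[l]}.
Implicit Types (M : 'M[S]_l) (A : multiarr F l).

(** Applying adj(M) M = det(M) to the gradient of [a], whose entry [i0] is 1, writes det(M) as a
    combination of the values on [a] of the rows. *)
Lemma rdvd_det_logder M (a : S) n i0 : mderiv i0 a = 1 ->
  (forall i, rdvd (a ^+ n) (vf_apply (row i M) a)) -> rdvd (a ^+ n) (\det M).
Proof.
move=> ai0 h.
have -> : \det M = \sum_i \adj M i0 i * vf_apply (row i M) a.
  under eq_bigr => i _ do rewrite mulr_sumr.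
  rewrite exchange_big /=.
  transitivity (\sum_j (\adj M *m M) i0 j * mderiv j a).
    rewrite mul_adj_mx (bigD1 i0) //= big1 => [|j ji].
      by rewrite mxE eqxx mulr1n ai0 mulr1 addr0.
    by rewrite mxE eq_sym (negbTE ji) mulr0n mul0r.
  apply: eq_bigr => j _; rewrite mxE mulr_suml; apply: eq_bigr => i _.
  by rewrite !mxE mulrA.
by apply: rdvd_sum => i _; apply: rdvdMl.
Qed.

Lemma saito_criterion A M :
  (forall N, (forall i, logder A (row i N)) -> rdvd (defpoly A) (\det N)) ->
  (forall i, logder A (row i M)) -> \det M != 0 ->
  (msize (\det M) <= msize (defpoly A))%N ->
  is_basis (logder A) (fun i => row i M).
Proof.
move=> dvdQ ldM detM0 szM; have [g eg] := dvdQ M ldM.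
have /andP[g0 Q0] : (g != 0) && (defpoly A != 0).
  by rewrite -negb_or -mulf_eq0 -eg.
(* The degree bound forces the quotient of the determinant by Q to be a constant. *)
have [c ec] : exists c, g = c%:MP.
  exists g@_0; apply: msize1_polyC; move: szM; rewrite eg msizeM //.
  move: Q0; rewrite -msize_poly_eq0.
  by move: (msize _) (msize _) => a b; lia.
have c0 : c != 0 by apply: contra_neq g0 => c0; rewrite ec c0 mpolyC0.
split=> [//|a e i|v ldv].
  have : (\row_i a i) *m M = 0.
    by rewrite mulmx_sum_row -[RHS]e; apply: eq_bigr => j _; rewrite mxE.
  move=> /(congr1 (mulmx^~ (\adj M))); rewrite -mulmxA mul_mx_adj mul0mx.
  rewrite mul_mx_scalar => /rowP/(_ i); rewrite !mxE => /eqP.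
  by rewrite mulf_eq0 (negbTE detM0) => /eqP.
(* Cramer's rule: this entry is the determinant of [M] with row [i] replaced by [v], whose rows are
   again logarithmic. *)
have cramer i : rdvd (defpoly A) ((v *m \adj M) 0 i).
  pose N : 'M[S]_l := \matrix_(a, j) if a == i then v 0 j else M a j.
  have -> : (v *m \adj M) 0 i = \det N.
    rewrite (expand_det_row N i) mxE; apply: eq_bigr => j _.
    rewrite !mxE eqxx; congr (_ * (_ * \det _)).
    by apply/matrixP => a b; rewrite !mxE eq_sym (negbTE (neq_lift _ _)).
  apply: dvdQ => a; have [->|ai] := eqVneq a i.
    suff -> : row i N = v by [].
    by apply/rowP => j; rewrite !mxE eqxx.
  suff -> : row a N = row a M by apply: ldM.
  by apply/rowP => j; rewrite !mxE (negbTE ai).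
have [h hP] := @fin_all_exists _ (fun=> S) (fun i b =>
  (v *m \adj M) 0 i = b * defpoly A) cramer.
exists (fun i => c^-1 *: h i).
have : v *m \adj M *m M = defpoly A *: ((\row_i h i) *m M).
  rewrite scalemxAl; congr (_ *m _).
  by apply/rowP => i; rewrite hP !mxE mulrC.
rewrite -mulmxA mul_adj_mx mul_mx_scalar eg ec => e.
have -> : v = c^-1%:MP *: ((\row_i h i) *m M).
  have e' : defpoly A *: (c%:MP *: v) = defpoly A *: ((\row_i h i) *m M).
    by rewrite scalerA mulrC.
  apply/rowP => j; have /rowP/(_ j) := e'; rewrite !mxE => /(mulfI Q0) <-.
  by rewrite mulrA -mpolyCM mulVf // mpolyC1 mul1r.
rewrite mulmx_sum_row scaler_sumr; apply: eq_bigr => i _.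
by rewrite mxE scalerA mul_mpolyC.
Qed.

Lemma msize_defpoly A : {in unzip1 A, forall a, msize a = 2} ->
  msize (defpoly A) = (\sum_(H <- A) H.2).+1.
Proof.
rewrite /defpoly; elim: A => [|[a n] A IH] h; first by rewrite !big_nil msize1.
have ha : msize a = 2 by apply: h; rewrite inE eqxx.
have nz (p : S) k : msize p = k.+1 -> p != 0.
  by rewrite -msize_poly_eq0 => ->.
rewrite !big_cons /=.
have {}IH : msize (\prod_(H <- A) H.1 ^+ H.2) = (\sum_(H <- A) H.2).+1.
  by apply: IH => b hb; apply: h; rewrite inE hb orbT.
have han : msize (a ^+ n) = n.+1.
  elim: n {h} => [|n IHn]; first by rewrite msize1.
  by rewrite exprS msizeM ?ha ?IHn // ?(nz _ _ ha) // (nz _ _ IHn).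
by rewrite msizeM ?(nz _ _ han) ?(nz _ _ IH) // han IH addSn addnS.
Qed.

End Saito.

(** The doubled count is the one met in the degree of Q, where each form for a pair has exponent
    2m. *)
Lemma sum_ltn_pairs l :
  ((\sum_(i < l) \sum_(j < l | (i < j)%N) 1) * 2 = l * (l - 1))%N.
Proof.
rewrite (exchange_big_dep xpredT) //=.
under eq_bigr => i _ do
  rewrite -(big_ord_widen l (fun=> 1)) 1?ltnW // sum1_card card_ord.
elim: l => [|[|n] IH]; rewrite ?big_ord0 // big_ord_recr /= ?big_ord0 // mulnDl IH.
by rewrite !subn1 -mulnDr addn2 mulnC.
Qed.

(** * The arrangement of a full monomial group *)

Section MonomialArrangement.
Variables (F : numClosedFieldType) (l r m : nat) (mu : 'I_l -> nat).
Hypothesis r_gt0 : (0 < r)%N.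
Local Notation S := {mpoly F[l]}.
Local Notation A := (mon_multiarr F r m mu).

Lemma size_unity_roots : size (unity_roots F r) = r.
Proof.
apply/eqP; rewrite -eqSS -(size_prod_XsubC _ id) -unity_rootsE //.
by rewrite -[1]/(1%:P) size_XnsubC.
Qed.

Lemma mem_mon_multiarr H : H \in A ->
  (exists i, H = ('X_i, mu i)) \/
  (exists (i j : 'I_l) (z : F), [/\ (i < j)%N, z ^+ r = 1
                  & H = ('X_i - z *: 'X_j, (2 * m)%N)]).
Proof.
rewrite mem_cat => /orP[/mapP[i _ ->]|]; first by left; exists i.
case/allpairsP => [[[i j] z] /= [+ + ->]]; rewrite mem_enum Defs.mem_unity_roots //.
by move=> lt /eqP z1; right; exists i, j, z.
Qed.

Lemma msize_linear_form (a : S) : a != 0 -> a \is 1.-homog -> msize a = 2.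
Proof.
move=> a0 ah; have e := dhomog_uniq a0 ah (dhomog_msize ah).
by move: a0 e; rewrite -msize_poly_eq0; case: (msize a) => [|n] //= _ <-.
Qed.

(** By degrees the quotient is constant, so distinct forms of a well-formed arrangement do not
    divide each other. *)
Lemma rdvd_linear_form (a b : S) : msize a = 2 -> msize b = 2 -> rdvd a b ->
  exists c : F, b = c *: a.
Proof.
move=> sa sb [g e].
have nz (p : S) : msize p = 2 -> p != 0 by rewrite -msize_poly_eq0 => ->.
have g0 : g != 0 by apply: contra_neq (nz _ sb) => g0; rewrite e g0 mul0r.
exists g@_0; rewrite -mul_mpolyC -msize1_polyC //.
by move: sb; rewrite e (msizeM g0 (nz _ sa)) sa addn2 /= => -[->].
Qed.

Lemma prime_mon_form H : H \in A -> prime_elt H.1.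
Proof.
move=> /mem_mon_multiarr[[i ->]|[i [j [z [lt _ ->]]]]] /=.
  exact: prime_XU.
by apply: prime_diff_form; rewrite neq_ltn lt.
Qed.

Lemma mderiv_mon_form H : H \in A -> exists i, mderiv i H.1 = 1.
Proof.
move=> /mem_mon_multiarr[[i ->]|[i [j [z [lt _ ->]]]]] /=; exists i.
  by rewrite mderivXU eqxx.
by rewrite mderivB mderivZ !mderivXU eqxx [j == i]gtn_eqF // scaler0 subr0.
Qed.

Lemma mon_multiarr_wf0 : multiarr_wf A.
Proof. by apply: mon_multiarr_wf; rewrite pnatr_eq0 -lt0n. Qed.

Lemma rdvd_det_mon_multiarr (N : 'M[S]_l) :
  (forall i, logder A (row i N)) -> rdvd (defpoly A) (\det N).
Proof.
move=> ldN; have [uA hA pA] := mon_multiarr_wf0.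
have sA a : a \in unzip1 A -> msize a = 2.
  by move=> /hA[]; apply: msize_linear_form.
apply: rdvd_prod_prime_exp => //.
- by move=> a /mapP[H /prime_mon_form ? ->].
- move=> a b aA bA /(rdvd_linear_form (sA _ aA) (sA _ bA))[c e].
  by apply/esym; apply: pA e.
- move=> H HA; have [i hi] := mderiv_mon_form HA.
  by apply: rdvd_det_logder hi _ => k; apply: ldN.
Qed.

Lemma msize_defpoly_mon_multiarr :
  msize (defpoly A) = (\sum_i mu i + l * (l - 1) * r * m).+1.
Proof.
have [_ hA _] := mon_multiarr_wf0.
rewrite msize_defpoly => [|a /hA[]]; last exact: msize_linear_form.
rewrite big_cat big_map big_enum /=; congr (_ + _).+1.
rewrite big_allpairs_dep /= big_enum_cond /=.
transitivity (\sum_(ij : 'I_l * 'I_l | (ij.1 < ij.2)%N) 1 * (2 * m * r))%N.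
  apply: eq_big => [[i j]|[i j] _]; first by rewrite andbT.
  by rewrite big_const_seq count_predT size_unity_roots iter_addn_0 mul1n.
rewrite -big_distrl -sum_ltn_pairs pair_big_dep /=.
by rewrite -!mulnA (mulnC m).
Qed.

End MonomialArrangement.

(** * Laurent integrals *)

Section LaurentIntegral.
Variables (F : numFieldType) (l : nat).
Local Notation S := {mpoly F[l]}.
Local Notation "x %:F" := (tofrac x).

Lemma laurent_int_comp_Xn (j : 'I_l) (e : int) (p : {poly S}) r :
  laurent_int j e (p \Po 'X^r) =
  \sum_(s < size p) (p`_s)%:F * ('X_j)%:F ^ (e + (r * s)%:Z + 1)
                    / (e + (r * s)%:Z + 1)%:~R.
Proof.
(* A common bound, large enough for the composite and for every index [r * s]. *)
pose N := (size (p \Po 'X^r) + (r * size p).+1)%N.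
rewrite (@laurent_int_wide _ _ j e _ N) ?leq_addr //.
transitivity (\sum_(n < N) \sum_(s < size p)
  (if n == (r * s)%N :> nat then (p`_s)%:F * ('X_j)%:F ^ (e + n%:Z + 1)
                    / (e + n%:Z + 1)%:~R else 0)).
  apply: eq_bigr => n _; rewrite comp_polyE coef_sum raddf_sum /= !mulr_suml.
  apply: eq_bigr => s _; rewrite -exprM coefZ coefXn.
  by case: eqP => _; rewrite ?mulr1 // mulr0 tofrac0 !mul0r.
rewrite exchange_big /=; apply: eq_bigr => s _; rewrite -big_mkcond /=.
have ltN : (r * s < N)%N.
  by rewrite /N ltn_addl // ltnS leq_mul2l (ltnW (ltn_ord s)) orbT.
by rewrite (big_pred1 (Ordinal ltN)).
Qed.

Lemma lambda_comp (r m : nat) (i : 'I_l) : (0 < m)%N ->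
  lambda F l r ^+ (m - 1) * lambda_i F r i = lam_poly F r m i \Po 'X^r.
Proof.
move=> m_gt0; rewrite lam_polyE // comp_polyM (rmorphXn (comp_poly _)) /=.
have h (Q : pred 'I_l) : \prod_(j < l | Q j) ('X - ('X_j ^+ r)%:P) \Po 'X^r =
    \prod_(j < l | Q j) ('X^r - ('X_j ^+ r)%:P) :> {poly S}.
  rewrite (rmorph_prod (comp_poly _)); apply: eq_bigr => j _ /=.
  by rewrite comp_polyB comp_polyX comp_polyC.
by rewrite !h.
Qed.

(** Links the integral in the fraction field to [wint]: the factor x_j^(rm) raises the exponents
    r(kap - m + s) + 1 to natural numbers. *)
Lemma laurent_int_wint (j : 'I_l) (k : int) (r m kap : nat) (p : {poly S}) :
  k + 1 = kap%:Z - m%:Z ->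
  laurent_int j (r%:Z * (k + 1)) (p \Po 'X^r) * ('X_j ^+ (r * m))%:F =
  ('X_j ^+ (r * kap + 1) * (wint r m kap p).['X_j ^+ r])%:F.
Proof.
move=> ->; rewrite laurent_int_comp_Xn mulr_suml /wint horner_poly mulr_sumr.
rewrite raddf_sum /=; apply: eq_bigr => s _.
set e := r%:Z * _ + _ + 1.
have xF0 : ('X_j : S)%:F != 0 by rewrite tofrac_eq0 mpolyXU_neq0.
have eE : (int_denom F r m kap s) = e%:~R.
  by rewrite /int_denom !pmulrn -rmorphB /=; congr _%:~R; rewrite /e; lia.
have ->: ('X_j ^+ (r * kap + 1) * ((int_denom F r m kap s)^-1 *: p`_s * ('X_j ^+ r) ^+ s)
  = (int_denom F r m kap s)^-1%:MP * p`_s * 'X_j ^+ (r * (kap + s) + 1))%R.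
  rewrite mul_mpolyC mulrCA -exprM -exprD; congr (_ * 'X_j ^+ _); lia.
pose f : {rmorphism F -> {fraction S}} := (@tofrac S) \o (@mpolyC l F).
have fe : ((int_denom F r m kap s)^-1%:MP : S)%:F = e%:~R^-1.
  by rewrite -[LHS]/(f _) fmorphV eE rmorph_int.
have fX : ('X_j : S)%:F ^+ (r * (kap + s) + 1) =
    ('X_j)%:F ^ e * ('X_j)%:F ^+ (r * m).
  by rewrite !exprnP -expfzDr //; congr (_ ^ _); rewrite /e; lia.
rewrite !tofracM fe !tofracXn fX.
move: (_ ^ e) (_ ^+ _) (_^-1) (tofrac _) => a b c d.
by rewrite (mulrAC d a c) (mulrC d c) mulrA.
Qed.

End LaurentIntegral.

(** * The basis property over an algebraically closed field of characteristic 0 *)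

Section MonomialBasis.
Variables (F : numClosedFieldType) (l r m kap : nat) (k : int).
Variables (mb mu : 'I_l -> nat).
Hypotheses (l_gt1 : (1 < l)%N) (r_gt1 : (1 < r)%N) (m_gt0 : (0 < m)%N).
Hypotheses (kapE : k + 1 = kap%:Z - m%:Z) (mb_le : forall i, (mb i <= r - 1)%N)
           (muE : forall i, (mu i + r = r * kap + 1 + mb i)%N).
Local Notation S := {mpoly F[l]}.

Lemma sigma_basis : exists theta : 'I_l -> vfield F l,
  (forall i, map_mx (@tofrac S) (theta i) =
             tofrac (('X_i : S) ^+ mb i) *: sigma F r m k i) /\
  is_basis (logder (mon_multiarr F r m mu)) theta.
Proof.
have r_gt0 := ltnW r_gt1.
have [theta [thetaE theta_dvd]] := coef_matrix_exists F r_gt1 m_gt0 mb_le muE.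
exists (fun i => row i theta); split=> [i|].
  apply/rowP => j; rewrite !mxE.
  have x0 : tofrac ('X_j ^+ (r * m) : S) != 0.
    by rewrite tofrac_eq0 expf_neq0 // mpolyXU_neq0.
  apply: (mulIf x0); rewrite -tofracM thetaE -!mulrA lambda_comp //.
  by rewrite (laurent_int_wint j r (lam_poly F r m i) kapE) -tofracM.
apply: saito_criterion.
- exact: rdvd_det_mon_multiarr.
- move=> i H /(mem_mon_multiarr r_gt0)[[j ->]|[j [j' [z [lt zr ->]]]]] /=.
    have [g e] := theta_dvd i j; exists g; rewrite -e /vf_apply (bigD1 j) //=.
    rewrite big1 => [|t tj].
      by rewrite mxE mderivXU eqxx mulr1 addr0.
    by rewrite mderivXU eq_sym (negbTE tj) mulr0.
  have jj' : j != j' by rewrite neq_ltn lt.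
  have [g e] := coef_matrix_diff r_gt1 m_gt0 thetaE i jj' zr.
  exists g; rewrite -e /vf_apply (bigD1 j) //= (bigD1 j') /=; last by rewrite eq_sym.
  rewrite big1 => [|t /andP[tj tj']].
    rewrite !mxE !mderivB !mderivZ !mderivXU !eqxx (negbTE jj') eq_sym (negbTE jj').
    by rewrite scaler0 subr0 mulr1 addr0 sub0r mulrN -scalerAr mulr1.
  rewrite mderivB mderivZ !mderivXU eq_sym (negbTE tj) eq_sym (negbTE tj').
  by rewrite scaler0 subrr mulr0.
- exact: coef_matrix_det thetaE.
- rewrite msize_defpoly_mon_multiarr //.
  have fD := @deg_filtration F l; have [_ D1 _ DM] := fD.
  (* [d i] bounds the degree of row [i]; these bounds add up exactly to the degree of Q. *)
  pose d i := (mb i + r * kap + 1 + r * (l * m - 1) - r * m)%N.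
  have dE i : d i = (mu i + (l - 1) * (r * m))%N.
    have lm : (l * m = (l - 1) * m + m)%N.
      by rewrite -mulSnr; congr (_ * _)%N; lia.
    have := muE i; have : (r * (l * m - 1) + r = (l - 1) * (r * m) + r * m)%N.
      rewrite -{2}[r]muln1 -mulnDr subnK; last by rewrite muln_gt0 m_gt0 ltnW.
      by rewrite lm mulnDr mulnCA.
    by rewrite /d; move: (r * (l * m - 1))%N (r * m)%N (_ * (r * m))%N; lia.
  have -> : (\sum_i mu i + l * (l - 1) * r * m = \sum_i d i)%N.
    under [RHS]eq_bigr do rewrite dE.
    by rewrite big_split /= sum_nat_const card_ord !mulnA.
  (* Leibniz expansion: the sign has degree 0 and each product takes one entry per row. *)
  apply: (filtration_sum fD) => s _; rewrite -[X in deg_filt X]add0n.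
  apply: DM; last first.
    by apply: (filtration_prod fD) => i _; apply: coef_matrix_deg.
  by apply: (filtration_exp fD (a := 0)); apply: filtrationN.
Qed.

End MonomialBasis.

Theorem theorem3p5 (R : realType) (l r m : nat) (k : int) (mb : 'I_l -> nat)
    (hl : (2 <= l)%N) (hr : (2 <= r)%N) (hm : (0 < m)%N)
    (hk : - m%:Z - 1 <= k)
    (hmb : forall i, (mb i <= r - 1)%N)
    (hmu : forall i, 0 <= coord_mult r m k (mb i)) :
  let A := mon_multiarr R[i] r m (fun i => `|coord_mult r m k (mb i)|%N)
  in
  exists theta : 'I_l -> vfield R[i] l,
    (forall i, map_mx (@tofrac {mpoly R[i][l]}) (theta i) =
               tofrac (('X_i : {mpoly R[i][l]}) ^+ mb i) *: sigma R[i] r m k i) /\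
    is_basis (logder A) theta.
Proof.
(* The shift kap = k + 1 + m is a natural number because k >= -m - 1. *)
have [kap kapE] : exists kap : nat, k + 1 = kap%:Z - m%:Z.
  by exists `|(k + 1 + m%:Z)%R|%N; lia.
apply: (sigma_basis R[i] hl hr hm kapE hmb) => i.
have e : coord_mult r m k (mb i) = (r * kap)%N%:Z - r%:Z + 1 + (mb i)%:Z.
  rewrite /coord_mult; have -> : k = kap%:Z - m%:Z - 1 by lia.
  by rewrite PoszM; ring.
by have := hmu i; rewrite e; lia.
Qed.
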